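(* Let $k\in\{3,4,5\}$, let $\mathcal{F}=(W,N,R,P)$ be an $Sk\pi$-frame and $C_0=\{\bot,\top\}$. For every world $w\in W$ and every valuation $g\colon V\rightarrow P$ there exist an $Sk^\forall_\equiv$-model $\mathcal{M}$ satisfying the Collapse Axiom and an assignment $\gamma\colon V\rightarrow M$ such that for all $\varphi\in Fm(C_0)$: $(\mathcal{M},\gamma)\vDash\varphi\Leftrightarrow(w,g)\vDash\varphi$. In particular, $(\mathcal{M},\gamma)\vDash\varphi\equiv\psi\Leftrightarrow(w,g)\vDash\varphi\equiv\psi$ for all $\varphi,\psi\in Fm(C_0)$, so $\varphi,\psi$ denote the same proposition in $\mathcal{M}$ iff they denote the same proposition in $\mathcal{F}$ at $w$.
   Context: Language: $Fm(C)$ is the set of formulas built from propositional variables $V$, a set $C$ of constants containing $\top,\bot$, connectives $\neg,\rightarrow,\vee,\wedge$, identity connective $\equiv$, necessity $\square$ and universal propositional quantifier $\forall$. The Collapse Axiom is the scheme $(\square\varphi\wedge\square\psi)\rightarrow(\varphi\equiv\psi)$. Frames: an $S3\pi$-frame is $(W,N,R,P)$ with $W$ a set of worlds, $\varnothing\neq N\subseteq W$ the normal worlds, $R\subseteq W\times W$ reflexive and transitive (a non-normal world accesses only itself), and $P\subseteq Pow(W)$ a set of propositions with $\varnothing,W\in P$ that is closed under formulas (every formula denotes an element of $P$ under every valuation). $S4\pi$-frames have $N=W$; $S5\pi$-frames have $N=W$ and $R$ an equivalence relation. A valuation is $g\colon V\to P$ with $g(\bot)=\varnothing$, $g(\top)=W$.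 At a normal world $w$: $(w,g)\vDash x$ iff $w\in g(x)$; $(w,g)\vDash c$ iff $w\in g(c)$; Boolean connectives classically; $(w,g)\vDash\square\varphi$ iff $(w',g)\vDash\varphi$ for all $w'$ with $wRw'$; $(w,g)\vDash\varphi\equiv\psi$ iff for all $w'$ with $wRw'$, $(w',g)\vDash\varphi\Leftrightarrow(w',g)\vDash\psi$; $(w,g)\vDash\forall x\varphi$ iff $(w,g')\vDash\varphi$ for all valuations $g'$ agreeing with $g$ off $x$. At non-normal worlds the same, except that $\square\varphi$ is always false. Models: a propositional domain is $\mathcal{M}=(M,\mathit{TRUE},\mathit{NEC},f_\bot,f_\top,f_\square,f_\neg,f_\vee,f_\wedge,f_\rightarrow,f_\equiv,f_\forall,\varGamma)$ with $\mathit{TRUE},\mathit{NEC}\subseteq M$, operations of obvious arities, $f_\forall\colon M^M\to M$, $\varGamma\colon C\to M$ with $\varGamma(\bot)=f_\bot,\varGamma(\top)=f_\top$; assignments $\gamma\colon V\to M$ extend homomorphically with $\gamma(c)=\varGamma(c)$ and $\gamma(\forall x\varphi)=f_\forall(m\mapsto\gamma_x^m(\varphi))$. $t\colon M\to M$ is $(\varphi,x,\gamma)$-definable if $t(m)=\gamma_x^m(\varphi)$ for all $m$ (definable if so for some $\varphi,x,\gamma$). With $a\le_\mathcal{M}b:\Leftrightarrow f_\rightarrow(a,b)\in\mathit{NEC}$ and $\approx_\mathcal{M}$ its symmetric part, $\mathcal{M}$ is an $S3^\forall_\equiv$-model if: (1) when $\mathit{NEC}\neq\varnothing$, $\le_\mathcal{M}$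 is a preorder making $(M,f_\bot,f_\top,f_\neg,f_\vee,f_\wedge,f_\rightarrow,\le_\mathcal{M})$ a Boolean prealgebra ($\approx_\mathcal{M}$ a congruence with Boolean-algebra quotient ordered by $\le_\mathcal{M}$); (2) $f_\bot\notin\mathit{TRUE}$, $f_\top\in\mathit{TRUE}$, classical truth conditions for $f_\rightarrow,f_\neg,f_\wedge,f_\vee$, $f_\square(a)\in\mathit{TRUE}\Leftrightarrow a\in\mathit{NEC}$, $f_\equiv(a,b)\in\mathit{TRUE}\Leftrightarrow a=b$, $f_\forall(t)\in\mathit{TRUE}$ for definable $t$ with image in $\mathit{TRUE}$; (3) when $\mathit{NEC}\neq\varnothing$, $\mathit{NEC}\subseteq\mathit{TRUE}$ is upward closed under $\le_\mathcal{M}$ and closed under $f_\wedge$; (4) when $\mathit{NEC}\neq\varnothing$: $f_\top\le_\mathcal{M}f_\equiv(a,a)$; $f_\equiv(a,b)\le_\mathcal{M}f_\rightarrow(a,b)$; $f_\equiv(a,b)\le_\mathcal{M}f_\equiv(t(a),t(b))$ for definable $t$; $f_\square(a)\le_\mathcal{M}a$; $f_\square(f_\rightarrow(a,b))\le_\mathcal{M}f_\rightarrow(f_\square(a),f_\square(b))$; $f_\square(f_\rightarrow(a,b))\le_\mathcal{M}f_\square(f_\rightarrow(f_\square(a),f_\square(b)))$; $f_\forall(t)\le_\mathcal{M}f_\equiv(f_\forall(t_1),f_\forall(t_2))$ and $f_\forall(t)\le_\mathcal{M}f_\rightarrow(f_\forall(t_1),f_\forall(t_2))$ for $t_1,t_2$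 $(\varphi,x,\gamma)$-, $(\psi,x,\gamma)$-definable and $t$ the pointwise $f_\equiv$, resp. $f_\rightarrow$, of $t_1,t_2$; $f_\forall(t)\le_\mathcal{M}t(a)$ for definable $t$; $f_\forall(t)\le_\mathcal{M}f_\rightarrow(b,f_\forall(t'))$ for $t'$ $(\psi,x,\gamma)$-definable, $b$ the denotation of a sentence and $t(a)=f_\rightarrow(b,t'(a))$; $f_\square(f_\forall(t))\approx_\mathcal{M}f_\forall(a\mapsto f_\square(t(a)))$ for definable $t$; $f_\forall(t)\in\mathit{NEC}$ for definable $t$ with image in $\mathit{NEC}$. It is normal if $\mathit{NEC}\neq\varnothing$. A normal $S3^\forall_\equiv$-model is an $S4^\forall_\equiv$-model if $f_\square(a)\le_\mathcal{M}f_\square(f_\square(a))$ for all $a$; an $S4^\forall_\equiv$-model is an $S5^\forall_\equiv$-model if $f_\neg(f_\square(a))\le_\mathcal{M}f_\square(f_\neg(f_\square(a)))$ for all $a$. $(\mathcal{M},\gamma)\vDash\varphi:\Leftrightarrow\gamma(\varphi)\in\mathit{TRUE}$. *)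

(* Defs.v *)
From mathcomp Require Import all_boot.
From mathcomp Require Import boolp classical_sets.

Set Implicit Arguments.
Unset Strict Implicit.
Unset Printing Implicit Defensive.

Local Open Scope classical_set_scope.

Definition var := nat.

Record constants := Constants {
  const_sort :> Type;
  const_bot : const_sort;
  const_top : const_sort;
  const_botNtop : const_bot <> const_top }.

Inductive const0 : Set := bot0 | top0.

Lemma bot0Ntop0 : bot0 <> top0. Proof. by []. Qed.

Definition C0 : constants := Constants bot0Ntop0.

Inductive fm (C : constants) : Type :=
| Var of var
| Const of C
| Neg of fm C
| Imp of fm C & fm C
| Or of fm C & fm C
| And of fm C & fm C
| Ident of fm C & fm C
| Box of fm C
| All of var & fm C.

Arguments Var {C}.

Fixpoint free_vars (C : constants) (phi : fm C) : seq var :=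
  match phi with
  | Var x => [:: x]
  | Const _ => [::]
  | Neg a | Box a => free_vars a
  | Imp a b | Or a b | And a b | Ident a b => free_vars a ++ free_vars b
  | All x a => [seq y <- free_vars a | y != x]
  end.

Definition sentence (C : constants) (phi : fm C) : Prop := free_vars phi = [::].

Inductive system : Set := S3 | S4 | S5.

Record preframe := Preframe {
  world :> Type;
  normal : set world;
  acc : world -> world -> Prop;
  props : set (set world) }.

(* A valuation interprets the constants as well as the variables; over [C0]
   the constant part is determined. *)
Record valuation (C : constants) (F : preframe) := Valuation {
  val_var : var -> set F;
  val_const : C -> set F;
  val_varP : forall x, props (val_var x);
  val_constP : forall c, props (val_const c);
  val_bot : val_const (const_bot C) = set0;
  val_top : val_const (const_top C) = setT }.

Definition agree_off (C : constants) (F : preframe) (x : var)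
    (g g' : valuation C F) : Prop :=
  (forall y, y <> x -> val_var g' y = val_var g y) /\
  (forall c, val_const g' c = val_const g c).

Fixpoint forces (C : constants) (F : preframe) (w : F) (g : valuation C F)
    (phi : fm C) {struct phi} : Prop :=
  match phi with
  | Var x => val_var g x w
  | Const c => val_const g c w
  | Neg a => ~ forces w g a
  | Imp a b => forces w g a -> forces w g b
  | Or a b => forces w g a \/ forces w g b
  | And a b => forces w g a /\ forces w g b
  | Ident a b => forall w', acc w w' -> (forces w' g a <-> forces w' g b)
  | Box a => normal w /\ forall w', acc w w' -> forces w' g a
  | All x a => forall g', agree_off x g g' -> forces w g' a
  end.

Definition denotes (C : constants) (F : preframe) (g : valuation C F)
    (phi : fm C) : set F := [set w | forces w g phi].

(* Propositions are compared at [w] on the worlds accessible from [w]. *)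
Definition same_prop_at (F : preframe) (w : F) (A B : set F) : Prop :=
  [set w' | acc w w'] `&` A = [set w' | acc w w'] `&` B.

Record is_S3pi_frame (C : constants) (F : preframe) : Prop := IsS3piFrame {
  normal_neq0 : @normal F !=set0;
  acc_refl : forall w : F, acc w w;
  acc_trans : forall w1 w2 w3 : F, acc w1 w2 -> acc w2 w3 -> acc w1 w3;
  acc_nonnormal : forall w w' : F, ~ normal w -> acc w w' -> w' = w;
  props_set0 : @props F set0;
  props_setT : @props F setT;
  props_closed : forall (g : valuation C F) (phi : fm C),
    props (denotes g phi) }.

Definition is_S4pi_frame (C : constants) (F : preframe) : Prop :=
  is_S3pi_frame C F /\ @normal F = setT.

Definition is_S5pi_frame (C : constants) (F : preframe) : Prop :=
  is_S4pi_frame C F /\ (forall w w' : F, acc w w' -> acc w' w).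

Definition is_pi_frame (k : system) (C : constants) (F : preframe) : Prop :=
  match k with
  | S3 => is_S3pi_frame C F
  | S4 => is_S4pi_frame C F
  | S5 => is_S5pi_frame C F
  end.

Record prop_domain (C : constants) := PropDomain {
  dom :> Type;
  TRUE : set dom;
  NEC : set dom;
  f_bot : dom;
  f_top : dom;
  f_box : dom -> dom;
  f_neg : dom -> dom;
  f_or : dom -> dom -> dom;
  f_and : dom -> dom -> dom;
  f_imp : dom -> dom -> dom;
  f_id : dom -> dom -> dom;
  f_all : (dom -> dom) -> dom;
  Gam : C -> dom;
  Gam_bot : Gam (const_bot C) = f_bot;
  Gam_top : Gam (const_top C) = f_top }.

Definition update (M : Type) (gam : var -> M) (x : var) (m : M) : var -> M :=
  fun y => if y == x then m else gam y.

Fixpoint den (C : constants) (M : prop_domain C) (gam : var -> M)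
    (phi : fm C) {struct phi} : M :=
  match phi with
  | Var x => gam x
  | Const c => Gam M c
  | Neg a => f_neg (den gam a)
  | Imp a b => f_imp (den gam a) (den gam b)
  | Or a b => f_or (den gam a) (den gam b)
  | And a b => f_and (den gam a) (den gam b)
  | Ident a b => f_id (den gam a) (den gam b)
  | Box a => f_box (den gam a)
  | All x a => f_all (fun m => den (update gam x m) a)
  end.

Definition sat (C : constants) (M : prop_domain C) (gam : var -> M)
    (phi : fm C) : Prop := TRUE (den gam phi).

Definition definable_by (C : constants) (M : prop_domain C) (phi : fm C)
    (x : var) (gam : var -> M) (t : M -> M) : Prop :=
  forall m, t m = den (update gam x m) phi.

Definition definable (C : constants) (M : prop_domain C) (t : M -> M) : Prop :=
  exists phi x gam, definable_by phi x gam t.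

Definition le_dom (C : constants) (M : prop_domain C) (a b : M) : Prop :=
  NEC (f_imp a b).

Definition equiv_dom (C : constants) (M : prop_domain C) (a b : M) : Prop :=
  le_dom a b /\ le_dom b a.

(* The quotient by [equiv_dom] is a Boolean algebra: its laws are stated on
   representatives. *)
Record boolean_prealgebra (C : constants) (M : prop_domain C) : Prop :=
    BooleanPrealgebra {
  bp_refl : forall a : M, le_dom a a;
  bp_trans : forall a b c : M, le_dom a b -> le_dom b c -> le_dom a c;
  bp_neg_congr : forall a a' : M,
    equiv_dom a a' -> equiv_dom (f_neg a) (f_neg a');
  bp_or_congr : forall a a' b b' : M, equiv_dom a a' -> equiv_dom b b' ->
    equiv_dom (f_or a b) (f_or a' b');
  bp_and_congr : forall a a' b b' : M, equiv_dom a a' -> equiv_dom b b' ->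
    equiv_dom (f_and a b) (f_and a' b');
  bp_imp_congr : forall a a' b b' : M, equiv_dom a a' -> equiv_dom b b' ->
    equiv_dom (f_imp a b) (f_imp a' b');
  bp_orC : forall a b : M, equiv_dom (f_or a b) (f_or b a);
  bp_andC : forall a b : M, equiv_dom (f_and a b) (f_and b a);
  bp_orA : forall a b c : M,
    equiv_dom (f_or a (f_or b c)) (f_or (f_or a b) c);
  bp_andA : forall a b c : M,
    equiv_dom (f_and a (f_and b c)) (f_and (f_and a b) c);
  bp_or_absorb : forall a b : M, equiv_dom (f_or a (f_and a b)) a;
  bp_and_absorb : forall a b : M, equiv_dom (f_and a (f_or a b)) a;
  bp_and_distr : forall a b c : M,
    equiv_dom (f_and a (f_or b c)) (f_or (f_and a b) (f_and a c));
  bp_or_distr : forall a b c : M,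
    equiv_dom (f_or a (f_and b c)) (f_and (f_or a b) (f_or a c));
  bp_or_bot : forall a : M, equiv_dom (f_or a (f_bot M)) a;
  bp_and_top : forall a : M, equiv_dom (f_and a (f_top M)) a;
  bp_or_neg : forall a : M, equiv_dom (f_or a (f_neg a)) (f_top M);
  bp_and_neg : forall a : M, equiv_dom (f_and a (f_neg a)) (f_bot M);
  bp_imp : forall a b : M, equiv_dom (f_imp a b) (f_or (f_neg a) b);
  bp_order : forall a b : M, le_dom a b <-> equiv_dom (f_and a b) a }.

Record truth_conditions (C : constants) (M : prop_domain C) : Prop :=
    TruthConditions {
  tc_bot : ~ TRUE (f_bot M);
  tc_top : TRUE (f_top M);
  tc_imp : forall a b : M, TRUE (f_imp a b) <-> (TRUE a -> TRUE b);
  tc_neg : forall a : M, TRUE (f_neg a) <-> ~ TRUE a;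
  tc_and : forall a b : M, TRUE (f_and a b) <-> TRUE a /\ TRUE b;
  tc_or : forall a b : M, TRUE (f_or a b) <-> TRUE a \/ TRUE b;
  tc_box : forall a : M, TRUE (f_box a) <-> NEC a;
  tc_id : forall a b : M, TRUE (f_id a b) <-> a = b;
  tc_all : forall t : M -> M,
    definable t -> (forall m, TRUE (t m)) -> TRUE (f_all t) }.

Record nec_filter (C : constants) (M : prop_domain C) : Prop := NecFilter {
  nf_true : @NEC C M `<=` @TRUE C M;
  nf_up : forall a b : M, NEC a -> le_dom a b -> NEC b;
  nf_and : forall a b : M, NEC a -> NEC b -> NEC (f_and a b) }.

Record modal_conditions (C : constants) (M : prop_domain C) : Prop :=
    ModalConditions {
  mc_id_refl : forall a : M, le_dom (f_top M) (f_id a a);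
  mc_id_imp : forall a b : M, le_dom (f_id a b) (f_imp a b);
  mc_id_subst : forall (t : M -> M) (a b : M), definable t ->
    le_dom (f_id a b) (f_id (t a) (t b));
  mc_T : forall a : M, le_dom (f_box a) a;
  mc_K : forall a b : M,
    le_dom (f_box (f_imp a b)) (f_imp (f_box a) (f_box b));
  mc_S3 : forall a b : M,
    le_dom (f_box (f_imp a b)) (f_box (f_imp (f_box a) (f_box b)));
  mc_all_id : forall (phi psi : fm C) x (gam : var -> M) (t1 t2 : M -> M),
    definable_by phi x gam t1 -> definable_by psi x gam t2 ->
    le_dom (f_all (fun m => f_id (t1 m) (t2 m))) (f_id (f_all t1) (f_all t2));
  mc_all_imp : forall (phi psi : fm C) x (gam : var -> M) (t1 t2 : M -> M),
    definable_by phi x gam t1 -> definable_by psi x gam t2 ->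
    le_dom (f_all (fun m => f_imp (t1 m) (t2 m)))
           (f_imp (f_all t1) (f_all t2));
  mc_all_inst : forall (t : M -> M) (a : M), definable t ->
    le_dom (f_all t) (t a);
  mc_all_const : forall (psi chi : fm C) x (gam gam' : var -> M) (t' : M -> M),
    definable_by psi x gam t' -> sentence chi ->
    le_dom (f_all (fun a => f_imp (den gam' chi) (t' a)))
           (f_imp (den gam' chi) (f_all t'));
  mc_barcan : forall t : M -> M, definable t ->
    equiv_dom (f_box (f_all t)) (f_all (fun a => f_box (t a)));
  mc_all_nec : forall t : M -> M,
    definable t -> (forall m, NEC (t m)) -> NEC (f_all t) }.

Definition is_normal (C : constants) (M : prop_domain C) : Prop :=
  @NEC C M !=set0.

Definition is_S3_model (C : constants) (M : prop_domain C) : Prop :=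
  [/\ is_normal M -> boolean_prealgebra M,
      truth_conditions M,
      is_normal M -> nec_filter M
    & is_normal M -> modal_conditions M].

Definition is_S4_model (C : constants) (M : prop_domain C) : Prop :=
  [/\ is_S3_model M, is_normal M
    & forall a : M, le_dom (f_box a) (f_box (f_box a))].

Definition is_S5_model (C : constants) (M : prop_domain C) : Prop :=
  is_S4_model M /\
  forall a : M, le_dom (f_neg (f_box a)) (f_box (f_neg (f_box a))).

Definition is_model (k : system) (C : constants) (M : prop_domain C) : Prop :=
  match k with
  | S3 => is_S3_model M
  | S4 => is_S4_model M
  | S5 => is_S5_model M
  end.

Definition satisfies_collapse (C : constants) (M : prop_domain C) : Prop :=
  forall (gam : var -> M) (phi psi : fm C),
    sat gam (Imp (And (Box phi) (Box psi)) (Ident phi psi)).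

(* Main.v *)
Require Import Defs.
From mathcomp Require Import all_boot.
From mathcomp Require Import boolp classical_sets.

(** The model at [w] has as elements the propositions of the frame restricted
    to the worlds accessible from [w], i.e. the propositions of the subframe
    generated by [w].  An element is true if it contains [w], and necessary if
    [w] is normal and it is the whole generated subframe; hence there is at most
    one necessary element and the Collapse Axiom holds.  Since accessibility is
    transitive, forcing at a world depends only on the valuation at the worlds
    accessible from it, so the operations of the frame descend to the
    restrictions and, by induction on formulas, denotations in the model are
    the restrictions of denotations in the frame. *)

Set Implicit Arguments.
Unset Strict Implicit.
Unset Printing Implicit Defensive.

Local Open Scope classical_set_scope.

(** * Locality of forcing *)

Section Valuations.
Variables (C : constants) (F : preframe).

Definition val_update (g : valuation C F) (x : var) (A : set F)
    (PA : props A) : valuation C F.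
Proof.
exists (update (val_var g) x A) (val_const g).
- by move=> y; rewrite /update; case: ifP => _ //; apply: val_varP.
- exact: val_constP.
- exact: val_bot.
- exact: val_top.
Defined.

Lemma agree_off_val_update g x A (PA : props A) :
  agree_off x g (val_update g x PA).
Proof. by split=> // y /eqP /negPf yx /=; rewrite /update yx. Qed.

(** By transitivity the agreement assumed at [v] passes to every world accessible from [v], so
    induction on [phi] with [v] and both valuations general handles [Box] and [Ident]. *)
Lemma forces_local (hF : is_S3pi_frame C F) (phi : fm C) (v : F)
    (g h : valuation C F) :
  (forall x u, acc v u -> val_var g x u <-> val_var h x u) ->
  (forall c u, acc v u -> val_const g c u <-> val_const h c u) ->
  forces v g phi <-> forces v h phi.
Proof.
have vv (u : F) : acc u u := acc_refl hF u.
have local_acc (g' h' : valuation C F) (v' u : F) : acc v' u ->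
    (forall x u', acc v' u' -> val_var g' x u' <-> val_var h' x u') ->
    (forall c u', acc v' u' -> val_const g' c u' <-> val_const h' c u') ->
  (forall x u', acc u u' -> val_var g' x u' <-> val_var h' x u') /\
  (forall c u', acc u u' -> val_const g' c u' <-> val_const h' c u').
  by move=> vu gh ghc; split=> x u' uu'; [apply: gh | apply: ghc];
    apply: (acc_trans hF) uu'.
elim: phi v g h => [x|c|a IHa|a IHa b IHb|a IHa b IHb|a IHa b IHb
  |a IHa b IHb|a IHa|x a IHa] v g h gh ghc /=.
- exact: gh.
- exact: ghc.
- by have := IHa v g h gh ghc; tauto.
- by have := IHa v g h gh ghc; have := IHb v g h gh ghc; tauto.
- by have := IHa v g h gh ghc; have := IHb v g h gh ghc; tauto.
- by have := IHa v g h gh ghc; have := IHb v g h gh ghc; tauto.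
- split=> ab u vu; have [gh' ghc'] := local_acc g h v u vu gh ghc;
    have := ab u vu; have := IHa u g h gh' ghc';
    have := IHb u g h gh' ghc'; tauto.
- split=> -[nv va]; split=> // u vu;
    have [gh' ghc'] := local_acc g h v u vu gh ghc;
    have := va u vu; have := IHa u g h gh' ghc'; tauto.
(* A variant [g2] of [h1] is matched by the variant of [g1] taking the value of [g2] at [x]. The
   roles of [g] and [h] are swapped for the converse. *)
- have upd (g1 h1 g2 : valuation C F) :
      (forall x u, acc v u -> val_var g1 x u <-> val_var h1 x u) ->
      (forall c u, acc v u -> val_const g1 c u <-> val_const h1 c u) ->
      agree_off x h1 g2 ->
      forces v (val_update g1 x (val_varP g2 x)) a <-> forces v g2 a.
    move=> gh1 ghc1 [h1g2 h1g2c]; apply: IHa => [y u vu|c u vu] /=.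
      rewrite /update; case: eqP => [->//|yx].
      by rewrite h1g2 //; apply: gh1.
    by rewrite h1g2c; apply: ghc1.
  split=> ga g' agg'.
    by apply/(upd g h) => //; apply/ga/agree_off_val_update.
  apply/(upd h g) => //.
  + by move=> y u vu; split=> /(gh y u vu).
  + by move=> c u vu; split=> /(ghc c u vu).
  + exact/ga/agree_off_val_update.
Qed.

End Valuations.

(** * Propositions of the generated subframe *)

Section Model.
Variables (C : constants) (F : preframe) (hF : is_S3pi_frame C F).
Variables (w : F) (g0 : valuation C F).

(** The extending proposition [B] is only asserted to exist, so elements with the same set are
    equal; [tc_id] demands genuine equality. *)
Definition local_prop : Type :=
  {A : set F | exists2 B, props B & A = [set v | acc w v] `&` B}.

Definition holds (a : local_prop) : set F := sval a.

Definition restrict (A : set F) (PA : props A) : local_prop :=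
  exist _ _ (ex_intro2 _ _ A PA erefl).

Lemma holds_restrict A (PA : props A) v :
  acc w v -> holds (restrict PA) v <-> A v.
Proof. by move=> wv; split=> [[]|]. Qed.

Lemma local_prop_ext (a b : local_prop) :
  (forall v, acc w v -> holds a v <-> holds b v) -> a = b.
Proof.
case: a b => [A PA] [B PB] /= ab; apply: eq_exist.
case: PA PB ab => A' _ -> [B' _ ->] ab.
by apply/seteqP; split=> v [wv Hv]; have := ab v wv => /=; tauto.
Qed.

Definition repr (a : local_prop) : set F := s2val (cid2 (proj2_sig a)).

Lemma repr_props a : props (repr a).
Proof. exact: s2valP. Qed.

Lemma reprE a v : acc w v -> repr a v <-> holds a v.
Proof.
move=> wv; rewrite /holds (s2valP' (cid2 (proj2_sig a))) -/(repr a).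
by split=> [|[]].
Qed.

Definition lift_asg (gam : var -> local_prop) : valuation C F :=
  @Valuation C F (fun x => repr (gam x)) (val_const g0)
    (fun x => repr_props (gam x)) (val_constP g0) (val_bot g0) (val_top g0).

(** Each operation of the model other than [f_all] evaluates a one-connective formula, so that
    [props_closed] supplies the closure of the domain. *)
Definition interp (gam : var -> local_prop) (phi : fm C) : local_prop :=
  restrict (props_closed hF (lift_asg gam) phi).

Lemma interpE gam phi v :
  acc w v -> holds (interp gam phi) v <-> forces v (lift_asg gam) phi.
Proof. exact: holds_restrict. Qed.

(** * The model at [w] *)

Definition asg2 (a b : local_prop) : var -> local_prop :=
  fun x => if x is 0 then a else b.

Definition local_const (c : C) : local_prop := restrict (val_constP g0 c).

Definition is_meet (t : local_prop -> local_prop) (a : local_prop) : Prop :=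
  forall v, acc w v -> holds a v <-> forall m, holds (t m) v.

(* Indexed meets need not be propositions of the frame; [f_all] is the meet
   whenever it exists, and an arbitrary junk value otherwise. *)
Definition local_all (t : local_prop -> local_prop) : local_prop :=
  if pselect (exists a, is_meet t a) is left ex then sval (cid ex)
  else local_const (const_bot C).

(** With [normal w] in its definition, [NEC] is empty at a non-normal [w], in accordance with the
    falsity of all boxed formulas there. *)
Definition local_model : prop_domain C :=
  @PropDomain C local_prop
    [set a | holds a w]
    [set a | normal w /\ forall v, acc w v -> holds a v]
    (local_const (const_bot C))
    (local_const (const_top C))
    (fun a => interp (asg2 a a) (Box (Var 0)))
    (fun a => interp (asg2 a a) (Neg (Var 0)))
    (fun a b => interp (asg2 a b) (Or (Var 0) (Var 1)))
    (fun a b => interp (asg2 a b) (And (Var 0) (Var 1)))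
    (fun a b => interp (asg2 a b) (Imp (Var 0) (Var 1)))
    (fun a b => interp (asg2 a b) (Ident (Var 0) (Var 1)))
    local_all
    local_const erefl erefl.

(** * Worldwise evaluation of the operations *)

Notation M := local_model.
Implicit Types (a b : M) (v u : F) (t : M -> M) (gam : var -> M).

Let acc_w v u : acc w v -> acc v u -> acc w u := @acc_trans _ _ hF w v u.
Let ww : acc w w := acc_refl hF w.

Lemma holds_bot v : acc w v -> holds (f_bot M) v = False.
Proof.
by move=> wv; apply/propext; rewrite holds_restrict // val_bot; split.
Qed.

Lemma holds_top v : acc w v -> holds (f_top M) v = True.
Proof.
by move=> wv; apply/propext; rewrite holds_restrict // val_top; split.
Qed.

Lemma holds_neg a v : acc w v -> holds (f_neg a) v = ~ holds a v.
Proof.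
by move=> wv; apply/propext; rewrite interpE //= -(reprE a).
Qed.

Lemma holds_or a b v :
  acc w v -> holds (f_or a b) v = (holds a v \/ holds b v).
Proof.
by move=> wv; apply/propext; rewrite interpE //= -(reprE a) // -(reprE b).
Qed.

Lemma holds_and a b v :
  acc w v -> holds (f_and a b) v = (holds a v /\ holds b v).
Proof.
by move=> wv; apply/propext; rewrite interpE //= -(reprE a) // -(reprE b).
Qed.

Lemma holds_imp a b v :
  acc w v -> holds (f_imp a b) v = (holds a v -> holds b v).
Proof.
by move=> wv; apply/propext; rewrite interpE //= -(reprE a) // -(reprE b).
Qed.

Lemma holds_id a b v : acc w v ->
  holds (f_id a b) v = (forall u, acc v u -> holds a u <-> holds b u).
Proof.
move=> wv; apply/propext; rewrite interpE //=.
by split=> ab u vu; have := ab u vu; rewrite !reprE //; apply: acc_w vu.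
Qed.

Lemma holds_box a v : acc w v ->
  holds (f_box a) v = (normal v /\ forall u, acc v u -> holds a u).
Proof.
move=> wv; apply/propext; rewrite interpE //=.
by split=> -[nv va]; split=> // u vu; have := va u vu; rewrite !reprE //;
  apply: acc_w vu.
Qed.

(** The given meet [a] excludes the junk branch, and all meets of [t] agree on the worlds accessible
    from [w]. *)
Lemma holds_all_meet t a : is_meet t a ->
  forall v, acc w v -> holds (f_all t) v = forall m, holds (t m) v.
Proof.
move=> ta v wv; apply/propext.
rewrite /= /local_all; case: pselect => [ex|[]]; last by exists a.
exact: (svalP (cid ex)).
Qed.

(** * Denotations in the model and forcing in the frame *)

(** A relation rather than a function: an assignment leaves the values of [h] outside the generated
    subframe open, and arbitrary variants of [h] occur under quantifiers. *)
Definition represents gam (h : valuation C F) : Prop :=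
  (forall x v, acc w v -> holds (gam x) v <-> val_var h x v) /\
  (forall c, val_const h c = val_const g0 c).

Lemma represents_lift gam : represents gam (lift_asg gam).
Proof. by split=> // x v wv /=; rewrite reprE. Qed.

Lemma represents_update gam h x m h' : represents gam h ->
  agree_off x h h' ->
  (forall v, acc w v -> holds m v <-> val_var h' x v) ->
  represents (update gam x m) h'.
Proof.
move=> [gh ghc] [hh' hhc'] mh'; split=> [y v wv|c]; last by rewrite hhc'.
rewrite /update; case: eqP => [->|yx]; first exact: mh'.
by rewrite hh' //; apply: gh.
Qed.

(** Variants of [h] at [x] and elements [m] correspond through [repr] and [restrict]. The claim for
    the body is a hypothesis, so the lemma serves inside the induction of [holds_den] and after
    it. *)
Lemma forces_AllE phi x gam h v :
  (forall gam h, represents gam h -> forall v, acc w v ->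
    holds (den gam phi) v <-> forces v h phi) ->
  represents gam h -> acc w v ->
  forces v h (All x phi) <-> forall m, holds (den (update gam x m) phi) v.
Proof.
move=> IH gh wv; split=> /= [vphi m|vphi h' hh'].
  have hh' := agree_off_val_update h x (repr_props m).
  apply/(IH _ (val_update h x (repr_props m))) => //; last exact: vphi.
  apply: represents_update gh hh' _ => u wu /=.
  by rewrite /update eqxx reprE.
apply/(IH (update gam x (restrict (val_varP h' x)))) => //.
by apply: represents_update gh hh' _ => u wu; rewrite holds_restrict.
Qed.

Lemma holds_den phi gam h : represents gam h ->
  forall v, acc w v -> holds (den gam phi) v <-> forces v h phi.
Proof.
elim: phi gam h => [x|c|a IHa|a IHa b IHb|a IHa b IHb|a IHa b IHb
  |a IHa b IHb|a IHa|x a IHa] gam h gh v wv.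
- exact: gh.1.
- by rewrite [den _ _]/= holds_restrict //= gh.2.
- by rewrite [den _ _]/= holds_neg //= (IHa _ _ gh).
- by rewrite [den _ _]/= holds_imp //= (IHa _ _ gh) // (IHb _ _ gh).
- by rewrite [den _ _]/= holds_or //= (IHa _ _ gh) // (IHb _ _ gh).
- by rewrite [den _ _]/= holds_and //= (IHa _ _ gh) // (IHb _ _ gh).
- rewrite [den _ _]/= holds_id //=.
  by split=> ab u vu; have := ab u vu;
    rewrite (IHa _ _ gh) ?(IHb _ _ gh) //; apply: acc_w vu.
- rewrite [den _ _]/= holds_box //=.
  by split=> -[nv va]; split=> // u vu; have := va u vu;
    rewrite (IHa _ _ gh) //; apply: acc_w vu.
(* The frame proposition denoted by [All x a] restricts to the required meet. *)
- rewrite [den _ _]/= (@holds_all_meet _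
    (restrict (props_closed hF h (All x a)))) //.
    by rewrite (forces_AllE x IHa gh).
  by move=> u wu; rewrite holds_restrict //; apply: forces_AllE.
Qed.

Lemma holds_all t v :
  definable t -> acc w v -> holds (f_all t) v = forall m, holds (t m) v.
Proof.
move=> [phi [x [gam tE]]]; move: v; apply: (@holds_all_meet _
  (interp gam (All x phi))) => v wv.
rewrite interpE // (forces_AllE _ (@holds_den phi) (represents_lift gam)) //.
by split=> H m; have := H m; rewrite tE.
Qed.

(** Forcing of the defining formula is local; this is what makes substitution under [f_id] valid at
    every world. *)
Lemma holds_definable_local t a b v : definable t -> acc w v ->
  (forall u, acc v u -> holds a u <-> holds b u) ->
  holds (t a) v <-> holds (t b) v.
Proof.
move=> [phi [x [gam tE]]] wv ab.
rewrite !tE !(holds_den _ (represents_lift _)) //.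
apply: forces_local => // y u vu; rewrite /= /update; case: ifP => // _.
by rewrite !reprE; [exact: ab | exact: acc_w vu | exact: acc_w vu].
Qed.

(** * Order and Boolean structure *)

Lemma local_leP a b :
  le_dom a b <-> normal w /\ forall v, acc w v -> holds a v -> holds b v.
Proof.
by split=> -[nw ab]; split=> // v wv; have := ab v wv; rewrite holds_imp.
Qed.

Lemma local_equiv_eq a b : equiv_dom a b -> a = b.
Proof.
move=> [/local_leP[_ ab] /local_leP[_ ba]]; apply: local_prop_ext => v wv.
by split; [apply: ab | apply: ba].
Qed.

Lemma local_eq_equiv a b : normal w -> a = b -> equiv_dom a b.
Proof. by move=> nw ->; split; apply/local_leP. Qed.

Definition holdsE :=
  (holds_bot, holds_top, holds_neg, holds_or, holds_and, holds_imp).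

Lemma local_boolean_prealgebra : normal w -> boolean_prealgebra M.
Proof.
move=> nw; split.
1: by move=> a; apply/local_leP.
1: move=> a b c /local_leP[_ ab] /local_leP[_ bc].
1: by apply/local_leP; split=> // v wv /(ab v wv); apply: bc.
1: by move=> a a' /local_equiv_eq ->; apply: local_eq_equiv.
1-3: by move=> a a' b b' /local_equiv_eq -> /local_equiv_eq ->;
  apply: local_eq_equiv.
(* Goal 14 is [bp_order]; the goals before it are Boolean identities, checked world by world
   below. *)
14: move=> a b; split=> [/local_leP[_ ab]|/local_equiv_eq <-].
14: by apply: local_eq_equiv => //; apply: local_prop_ext => v wv;
  have := ab v wv; rewrite !holdsE //; tauto.
14: by apply/local_leP; split=> // v wv; rewrite !holdsE //; tauto.
all: intros; apply: local_eq_equiv => //; apply: local_prop_ext => v wv;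
  rewrite !holdsE //.
all: try by tauto.
(* Laws such as [bp_or_neg] and [bp_imp] are classical. *)
all: case: (EM (holds a v)); tauto.
Qed.

(** * Truth, necessity and modal conditions *)

Lemma local_trueE a : @TRUE C M a = holds a w.
Proof. by []. Qed.

Lemma local_truth_conditions : truth_conditions M.
Proof.
split=> [||a b|a|a b|a b|a|a b|t dt tm].
- by rewrite !local_trueE holds_bot.
- by rewrite !local_trueE holds_top.
- by rewrite !local_trueE holds_imp.
- by rewrite !local_trueE holds_neg.
- by rewrite !local_trueE holds_and.
- by rewrite !local_trueE holds_or.
- by rewrite local_trueE holds_box.
(* Identity at [w] is agreement on the whole generated subframe, hence equality of elements. *)
- rewrite !local_trueE holds_id //; split=> [ab|-> //].
  exact: local_prop_ext.
- by rewrite local_trueE holds_all.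
Qed.

Lemma local_nec_filter : nec_filter M.
Proof.
split.
- by move=> a [_ wa]; apply: wa.
- move=> a b [nw wa] /local_leP[_ ab]; split=> // v wv.
  exact: (ab v wv (wa v wv)).
- move=> a b [nw wa] [_ wb]; split=> // v wv.
  by rewrite holds_and //; split; [apply: wa | apply: wb].
Qed.

Lemma local_modal_conditions : normal w -> modal_conditions M.
Proof.
move=> nw; split.
- by move=> a; apply/local_leP; split=> [|v wv _]; rewrite ?holds_id.
- move=> a b; apply/local_leP; split=> // v wv.
  rewrite holds_id // holds_imp // => ab.
  by have [] := ab v (acc_refl hF v).
- move=> t a b dt; apply/local_leP; split=> // v wv.
  rewrite !holds_id // => ab u vu.
  apply: holds_definable_local (acc_w wv vu) _ => // u' uu'.
  by apply: ab; apply: (acc_trans hF) uu'.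
- move=> a; apply/local_leP; split=> // v wv.
  by rewrite holds_box // => -[_]; apply; apply: (acc_refl hF).
- move=> a b; apply/local_leP; split=> // v wv.
  rewrite holds_imp // !holds_box // => -[_ ab] [nv va]; split=> // u vu.
  by have := ab u vu; rewrite holds_imp; [apply; apply: va | apply: acc_w vu].
- move=> a b; apply/local_leP; split=> // v wv.
  rewrite !holds_box // => -[nv ab]; split=> // u vu.
  have wu := acc_w wv vu.
  (* The world [u] may be non-normal; the normality needed for [f_box b] is read off from [f_box a]
     at [u]. *)
  rewrite holds_imp // !holds_box // => -[nu ua]; split=> // u' uu'.
  have := ab u' (acc_trans hF vu uu'); rewrite holds_imp.
    by apply; apply: ua.
  exact: acc_w uu'.
- move=> phi psi x gam t1 t2 d1 d2; apply/local_leP; split=> // v wv.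
  have dt1 : definable t1 by exists phi, x, gam.
  have dt2 : definable t2 by exists psi, x, gam.
  rewrite holds_all //; last first.
    by exists (Ident phi psi), x, gam => m; rewrite d1 d2.
  rewrite holds_id // => t12 u vu; have wu := acc_w wv vu.
  rewrite !holds_all //.
  have {}t12 m : holds (t1 m) u <-> holds (t2 m) u.
    by have := t12 m; rewrite holds_id // => /(_ u vu).
  by split=> H m; apply/t12.
- move=> phi psi x gam t1 t2 d1 d2; apply/local_leP; split=> // v wv.
  have dt1 : definable t1 by exists phi, x, gam.
  have dt2 : definable t2 by exists psi, x, gam.
  rewrite holds_all //; last first.
    by exists (Imp phi psi), x, gam => m; rewrite d1 d2.
  rewrite holds_imp // => t12.
  rewrite !holds_all //.
  by move=> H m; have := t12 m; rewrite holds_imp //; apply.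
- move=> t a dt; apply/local_leP; split=> // v wv.
  by rewrite holds_all.
- move=> psi chi x gam gam' t' d' _; apply/local_leP; split=> // v wv.
  have dt' : definable t' by exists psi, x, gam.
  set b := den gam' chi.
  (* The map under [f_all] mixes the assignments [gam] and [gam'], so its meet is exhibited directly
     instead of through a defining formula. *)
  rewrite (@holds_all_meet _ (f_imp b (f_all t'))) //.
    rewrite holds_imp // holds_all // => bt' vb m.
    by have := bt' m; rewrite holds_imp //; apply.
  move=> u wu; rewrite holds_imp // holds_all //.
  split=> [H m|H ub m]; first by rewrite holds_imp // => ub; apply: H.
  by have := H m; rewrite holds_imp //; apply.
- move=> t dt; apply: local_eq_equiv => //; apply: local_prop_ext => v wv.
  have dbt : definable (fun a => f_box (t a)).
    by have [phi [x [gam tE]]] := dt; exists (Box phi), x, gam => m; rewrite tE.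
  rewrite holds_box // holds_all //; split=> [[nv vt] m|vt].
    rewrite holds_box //; split=> // u vu.
    by have := vt u vu; rewrite holds_all //; apply: acc_w vu.
  have {}vt m : normal v /\ forall u, acc v u -> holds (t m) u.
    by rewrite -holds_box.
  (* Normality of [v] needs some instance of [vt]; [f_top M] is an arbitrary choice. *)
  split=> [|u vu]; first by have [] := vt (f_top M).
  rewrite holds_all //; last exact: acc_w vu.
  by move=> m; have [_] := vt m; apply.
- move=> t dt tN; split=> // v wv; rewrite holds_all // => m.
  by have [_] := tN m; apply.
Qed.

(** * The three systems and the Collapse Axiom *)

Lemma local_S3_model : is_S3_model M.
Proof.
(* Any element of [NEC] witnesses that [w] is normal. *)
split=> [[_ [nw _]]|||[_ [nw _]]].
- exact: local_boolean_prealgebra.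
- exact: local_truth_conditions.
- by move=> _; exact: local_nec_filter.
- exact: local_modal_conditions.
Qed.

Lemma local_S4_model : @normal F = setT -> is_S4_model M.
Proof.
move=> NT; have nv v : normal v by rewrite NT.
split; first exact: local_S3_model.
  by exists (f_top M); split=> // v wv; rewrite holds_top.
move=> a; apply/local_leP; split=> // v wv.
rewrite !holds_box // => -[_ va]; split=> // u vu.
rewrite holds_box; last exact: acc_w vu.
by split=> // u' uu'; apply: va; apply: (acc_trans hF) uu'.
Qed.

Lemma local_S5_model : @normal F = setT ->
  (forall v u, acc v u -> acc u v) -> is_S5_model M.
Proof.
move=> NT accC; have nv v : normal v by rewrite NT.
split; first exact: local_S4_model.
move=> a; apply/local_leP; split=> // v wv.
rewrite holds_neg // !holds_box // => va; split=> // u vu.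
have wu := acc_w wv vu; rewrite holds_neg // holds_box // => -[_ ua].
(* By symmetry and transitivity, [u] accesses every world that [v] accesses, so [f_box a] at [u]
   would give it at [v]. *)
apply: va; split=> // u' vu'; apply: ua.
exact: (acc_trans hF) (accC _ _ vu) vu'.
Qed.

Lemma local_collapse : satisfies_collapse M.
Proof.
move=> gam phi psi; have tc := local_truth_conditions.
rewrite /sat /= -/(den gam phi); apply/(tc_imp tc) => /(tc_and tc)[].
move=> /(tc_box tc)[_ wphi] /(tc_box tc)[_ wpsi]; apply/(tc_id tc).
by apply: local_prop_ext => v wv; split=> _; [apply: wpsi | apply: wphi].
Qed.

(** * The assignment induced by the valuation *)

Definition local_asg : var -> M := fun x => restrict (val_varP g0 x).

Lemma represents_local_asg : represents local_asg g0.
Proof. by split=> // x v wv; rewrite holds_restrict. Qed.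

Lemma sat_local_asg phi : sat local_asg phi <-> forces w g0 phi.
Proof. exact: holds_den represents_local_asg _ ww. Qed.

Lemma den_local_asg_eq phi psi : den local_asg phi = den local_asg psi <->
  same_prop_at w (denotes g0 phi) (denotes g0 psi).
Proof.
have dE := fun phi => holds_den phi represents_local_asg.
split=> [E|E].
  by apply/seteqP; split=> v [wv /= Hv]; split=> //=;
    apply/dE => //; [rewrite -E | rewrite E]; apply/dE.
apply: local_prop_ext => v wv; rewrite !dE //.
have Ev : (acc w v /\ forces v g0 phi) = (acc w v /\ forces v g0 psi).
  exact: (congr1 (fun A : set F => A v) E).
have : (acc w v /\ forces v g0 phi) <-> (acc w v /\ forces v g0 psi).
  by rewrite Ev.
tauto.
Qed.

End Model.

(** * The result for all three systems *)

Lemma is_pi_frame_S3 k C F : is_pi_frame k C F -> is_S3pi_frame C F.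
Proof. by case: k => //= [[]|[[]]]. Qed.

Lemma local_model_is_model k C F (hF : is_pi_frame k C F) w g0 :
  is_model k (local_model (is_pi_frame_S3 hF) w g0).
Proof.
(* The model depends on [hF]; generalizing its [S3] part first permits the case analysis on [k]. *)
move: (is_pi_frame_S3 hF) => hF3; case: k hF => /=.
- by move=> _; exact: local_S3_model.
- by move=> [_ NT]; exact: local_S4_model.
- by move=> [[_ NT] accC]; exact: local_S5_model.
Qed.

Theorem theorem33 (k : system) (F : preframe) (hF : is_pi_frame k C0 F)
    (w : F) (g : valuation C0 F) :
  exists (M : prop_domain C0) (gam : var -> M),
    [/\ is_model k M,
        satisfies_collapse M,
        (forall phi : fm C0, sat gam phi <-> forces w g phi),
        (forall phi psi : fm C0,
            sat gam (Ident phi psi) <-> forces w g (Ident phi psi))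
      & (forall phi psi : fm C0,
            den gam phi = den gam psi <->
            same_prop_at w (denotes g phi) (denotes g psi))].
Proof.
exists (local_model (is_pi_frame_S3 hF) w g), (local_asg _ w g); split.
- exact: local_model_is_model.
- exact: local_collapse.
- exact: sat_local_asg.
- by move=> phi psi; exact: sat_local_asg.
- exact: den_local_asg_eq.
Qed.
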